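(* For all integers $k\ge 1$ and $n\ge 1$, \[ \bigl|\overline{\mathcal M}^k_n\bigr|=\bigl|\mathcal E^k_n\bigr|=\frac{1}{n}\binom{(k+1)n}{n+1}. \]
   Context: Let $k$ be a positive integer. An elevated $k_0$-Dyck path is a lattice path consisting of up-steps $(1,k)$ and down-steps $(1,-1)$ that starts and ends on the line $y=j$ for some integer $j$ with $0\le j<k$ (the same $j$ at start and end), and stays weakly above the $x$-axis. Let $\mathcal E^k_n$ be the set of elevated $k_0$-Dyck paths with $n$ up-steps (and hence $kn$ down-steps). Let $\mathcal M^k_n$ be the set of $(k+1)\times n$ matrices with entries in $\{0,1\}$ having exactly $n+1$ entries equal to $1$ (and $kn-1$ entries equal to $0$). Two matrices in $\mathcal M^k_n$ are CPC-equivalent if one is obtained from the other by a cyclic permutation of its columns; $\overline{\mathcal M}^k_n$ denotes the set of CPC-equivalence classes of $\mathcal M^k_n$. *)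

(* Defs.v *)
From mathcomp Require Import all_boot all_order all_algebra.
From mathcomp Require Import zify ring lra.

Set Implicit Arguments.
Unset Strict Implicit.
Unset Printing Implicit Defensive.

Import Order.TTheory GRing.Theory Num.Theory.

Local Open Scope ring_scope.

(* A path is a starting height together with its word of steps:
   true is the up-step (1,k) and false is the down-step (1,-1). *)
Definition step_rise (k : nat) (b : bool) : int := if b then k%:Z else - 1.

Definition height (k j : nat) (s : seq bool) : int :=
  j%:Z + \sum_(b <- s) step_rise k b.

Definition weakly_above (k j : nat) (s : seq bool) : bool :=
  [forall i : 'I_(size s).+1, 0 <= height k j (take i s)].

Definition elevated_dyck (k j : nat) (s : seq bool) : bool :=
  [&& (j < k)%N, height k j s == j%:Z & weakly_above k j s].

Definition up_steps (s : seq bool) : nat := count_mem true s.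

Lemma elevated_dyck_down_steps (k j : nat) (s : seq bool) :
  elevated_dyck k j s -> count_mem false s = (k * up_steps s)%N.
Proof.
case/and3P=> _ /eqP + _; rewrite /height /up_steps => /eqP.
rewrite -subr_eq0 addrAC subrr add0r => /eqP.
have -> : \sum_(b <- s) step_rise k b =
  (k * count_mem true s)%N%:Z - (count_mem false s)%:Z.
  elim: s => [|b s IH]; first by rewrite big_nil /= muln0.
  by rewrite big_cons IH /step_rise; case: b => /=; lia.
lia.
Qed.

Lemma size_elevated_dyck (k j n : nat) (s : seq bool) :
  elevated_dyck k j s -> up_steps s = n -> size s = (k.+1 * n)%N.
Proof.
move=> /elevated_dyck_down_steps + Hn; rewrite Hn => Hd.
rewrite -(count_predC (pred1 true)) -/(up_steps s) Hn mulSn -Hd.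
by congr (_ + _)%N; apply: eq_count; case.
Qed.

(* By size_elevated_dyck, fixing the length loses no path with n up-steps. *)
Definition elevated_paths (k n : nat) : {set 'I_k * (k.+1 * n).-tuple bool} :=
  [set p : 'I_k * (k.+1 * n).-tuple bool |
    elevated_dyck k p.1 p.2 & up_steps p.2 == n].

(* The entry 1 is true and the entry 0 is false. *)
Definition matricesM (k n : nat) : {set 'M[bool]_(k.+1, n)} :=
  [set A : 'M[bool]_(k.+1, n) |
    #|[set ij : 'I_k.+1 * 'I_n | A ij.1 ij.2]| == n.+1].

(* Column j of rot_cols r A is column j + r (mod n) of A. *)
Definition rot_cols (k n r : nat) (A : 'M[bool]_(k.+1, n)) :
  'M[bool]_(k.+1, n) := colsub (iter r (@ordS n)) A.

Definition cpc (k n : nat) : rel 'M[bool]_(k.+1, n) :=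
  fun A B => [exists r : 'I_n, B == rot_cols r A].

Lemma iter_ordS (n r : nat) (i : 'I_n) :
  iter r (@ordS n) i = ((i + r) %% n)%N :> nat.
Proof.
elim: r => [|r IH] /=; first by rewrite addn0 modn_small.
by rewrite IH -addn1 modnDml addn1 addnS.
Qed.

Lemma rot_cols_cpc (k n r : nat) (A : 'M[bool]_(k.+1, n)) :
  (0 < n)%N -> cpc A (rot_cols r A).
Proof.
move=> n0; apply/existsP; exists (Ordinal (ltn_pmod r n0)); apply/eqP/matrixP.
by move=> i j; rewrite !mxE; congr (A i _); apply: val_inj;
  rewrite /= !iter_ordS modnDmr.
Qed.

Lemma rot_colsD (k n r r' : nat) (A : 'M[bool]_(k.+1, n)) :
  rot_cols r (rot_cols r' A) = rot_cols (r' + r) A.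
Proof. by apply/matrixP=> i j; rewrite !mxE iterD. Qed.

Lemma rot_colsn (k n : nat) (A : 'M[bool]_(k.+1, n)) : rot_cols n A = A.
Proof.
apply/matrixP=> i j; rewrite !mxE; congr (A i _); apply: val_inj.
by rewrite /= iter_ordS modnDr modn_small.
Qed.

Lemma cpc_equivalence (k n : nat) : (0 < n)%N -> equivalence_rel (@cpc k n).
Proof.
move=> n0.
have refl (A : 'M[bool]_(k.+1, n)) : cpc A A.
  by have := rot_cols_cpc n A n0; rewrite rot_colsn.
have trans (A B C : 'M[bool]_(k.+1, n)) : cpc A B -> cpc B C -> cpc A C.
  move=> /existsP[r /eqP->] /existsP[r' /eqP->].
  by rewrite rot_colsD rot_cols_cpc.
have sym (A B : 'M[bool]_(k.+1, n)) : cpc A B -> cpc B A.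
  move=> /existsP[r /eqP->]; have := rot_cols_cpc (n - r) (rot_cols r A) n0.
  by rewrite rot_colsD subnKC ?rot_colsn // ltnW.
move=> A B C; split=> // AB; apply/idP/idP; last exact: trans.
by apply: trans; apply: sym.
Qed.

Definition cpc_classes (k n : nat) : {set {set 'M[bool]_(k.+1, n)}} :=
  equivalence_partition (@cpc k n) (matricesM k n).

(* Main.v *)
Require Import Defs.
From mathcomp Require Import all_boot all_order all_algebra.
From mathcomp Require Import zify.

Import Order.TTheory GRing.Theory Num.Theory.

(** Cut a word of (k + 1) n letters into n blocks of length k + 1; blocks are the
    columns of a matrix with n + 1 ones.  Column sums minus 1 add up to 1, so by
    the cycle lemma exactly one of the n rotations is dominating: for every
    1 <= i <= n its first i columns contain more than i ones.  Hence the classes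
    have n elements each and are counted by the dominating matrices.
    A path from height j with n up-steps stays weakly above the axis iff, for
    0 <= i < n, its first j + 1 + (k + 1) i steps contain more than i up-steps.
    In particular it ends with k - j down-steps, so it is u v 0^(k-j) with
    |u| = j + 1; the word u 1 0^(k-j-1) v is then dominating.  Conversely the
    first block of a dominating word has at least two ones, and j is recovered
    from the position of the last of them. *)

(** * The cycle lemma *)

(** Take r to be the last minimum of P r - r on [0, n): later values are strictly larger, and
    wrapping around adds 1. *)
Lemma cycle_lemma_exists (n : nat) (P : nat -> nat) :
  0 < n -> (forall m, P (m + n) = P m + n.+1) ->
  exists2 r, r < n & forall m, 0 < m <= n -> m + P r < P (r + m).
Proof.
(* The lexicographic order on (P r + n - r, n - r) is packed into one number; the factor n suffices
   since the tie-breaks differ by less than n. *)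
move=> n0 Pn; pose F (r : 'I_n) := (P r + (n - r)) * n + (n - r).
case: (@arg_minnP _ (Ordinal n0) xpredT F isT) => r _ rmin.
exists r => // m /andP[m0 mn].
have [lt_n|ge_n] := ltnP (r + m) n.
  have := rmin (Ordinal lt_n) isT; rewrite /F /=.
  have := ltn_ord r; nia.
have lt_n : r + m - n < n by have := ltn_ord r; lia.
have := rmin (Ordinal lt_n) isT; have := Pn (r + m - n); rewrite subnK // /F /= => ->.
have := ltn_ord r; nia.
Qed.

(** For r < r' the hypotheses give P r - r < P r' - r' < P r - r + 1, impossible for integers. *)
Lemma cycle_lemma_unique (n : nat) (P : nat -> nat) (r r' : nat) :
  (forall m, P (m + n) = P m + n.+1) -> r < n -> r' < n ->
  (forall m, 0 < m <= n -> m + P r < P (r + m)) ->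
  (forall m, 0 < m <= n -> m + P r' < P (r' + m)) -> r = r'.
Proof.
move=> Pn; wlog lt_rr : r r' / r < r'.
  move=> IH rn r'n Hr Hr'; have [/IH->|/IH H|] // := ltngtP r r'.
  by rewrite H.
move=> rn r'n /(_ (r' - r)) + /(_ (r + n - r')).
rewrite !subnKC ?Pn; lia.
Qed.

(** * Dominating matrices *)

Section Columns.

Variables k n : nat.
Implicit Type A : 'M[bool]_(k.+1, n.+1).

(** [inZp] wraps the column index, so that prefix counts run on periodically past the last column,
    as the cycle lemma requires. *)
Definition col_ones A (m : nat) : nat :=
  \sum_(0 <= j < m) \sum_(i < k.+1) A i (inZp j).

Definition dominating A : bool :=
  [forall m : 'I_n.+1, m.+1 < col_ones A m.+1].

Lemma col_ones_rot (r m : nat) A :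
  col_ones A (r + m) = col_ones A r + col_ones (rot_cols r A) m.
Proof.
rewrite /col_ones (@big_cat_nat _ _ _ r) ?leq_addr //=; congr (_ + _).
rewrite addnC -{1}[r]add0n big_addn addnK.
apply: eq_bigr => j _; apply: eq_bigr => i _; rewrite mxE; congr (nat_of_bool (A _ _)).
by apply: val_inj; rewrite /= iter_ordS /= modnDml.
Qed.

Lemma in_matricesM A : (A \in matricesM k n.+1) = (col_ones A n.+1 == n.+2).
Proof.
rewrite inE /col_ones -sum1dep_card big_mkcond /=.
have -> : \sum_(0 <= j < n.+1) \sum_(i < k.+1) A i (inZp j) =
          \sum_(ij : 'I_k.+1 * 'I_n.+1) A ij.1 ij.2.
  rewrite big_mkord exchange_big pair_big /=; apply: eq_bigr => -[i j] _ /=.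
  by rewrite valZpK.
by congr (_ == _); apply: eq_bigr => -[i j] _; case: (A _ _).
Qed.

Lemma col_ones_period A m : A \in matricesM k n.+1 ->
  col_ones A (m + n.+1) = col_ones A m + n.+2.
Proof.
by rewrite in_matricesM addnC col_ones_rot rot_colsn addnC => /eqP ->.
Qed.

Lemma rot_cols_matricesM r A :
  A \in matricesM k n.+1 -> rot_cols r A \in matricesM k n.+1.
Proof.
move=> AM; rewrite in_matricesM -(eqn_add2l (col_ones A r)) -col_ones_rot.
by rewrite col_ones_period.
Qed.

Lemma dominating_rotP r A :
  reflect (forall m, 0 < m <= n.+1 -> m + col_ones A r < col_ones A (r + m))
          (dominating (rot_cols r A)).
Proof.
apply: (iffP forallP) => [dA [//|m] /= m_le | dA m].
  by have := dA (Ordinal m_le); rewrite col_ones_rot /=; lia.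
by have := dA m.+1; rewrite col_ones_rot /= ltn_ord => /(_ isT); lia.
Qed.

Lemma dominating_rot_exists A : A \in matricesM k n.+1 ->
  exists r : 'I_n.+1, dominating (rot_cols r A).
Proof.
move=> AM; have [r rn Pr] :=
  cycle_lemma_exists _ _ (ltn0Sn n) (fun m => col_ones_period _ m AM).
by exists (Ordinal rn); apply/dominating_rotP.
Qed.

Lemma dominating_rot_unique A (r r' : 'I_n.+1) : A \in matricesM k n.+1 ->
  dominating (rot_cols r A) -> dominating (rot_cols r' A) -> r = r'.
Proof.
move=> AM /dominating_rotP Pr /dominating_rotP Pr'; apply: val_inj.
exact: cycle_lemma_unique (fun m => col_ones_period _ m AM)
  (ltn_ord r) (ltn_ord r') Pr Pr'.
Qed.

Lemma cpc_partition :
  partition (cpc_classes k n.+1) (matricesM k n.+1).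
Proof.
by apply: equivalence_partitionP => A B C _ _ _; apply: cpc_equivalence.
Qed.

(** By the cycle lemma each class has exactly one dominating member, so these members form a
    transversal. *)
Lemma card_cpc_classes_dominating :
  #|cpc_classes k n.+1| = #|[set A in matricesM k n.+1 | dominating A]|.
Proof.
apply/esym/(@card_transversal _ _ _ (matricesM k n.+1)).
rewrite /is_transversal cpc_partition /=; apply/andP; split.
  by apply/subsetP => A /setIdP[].
apply/'forall_implyP => _ /imsetP[A AM ->]; apply/cards1P.
have [r dA] := dominating_rot_exists _ AM; exists (rot_cols r A).
apply/setP => B; apply/setIP/set1P => [|->].
  case=> /setIdP[_ dB] /setIdP[_ /existsP[r' /eqP eB]].
  by rewrite eB in dB *; rewrite (dominating_rot_unique _ _ _ AM dA dB).
by split; apply/setIdP; rewrite rot_cols_matricesM // rot_cols_cpc.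
Qed.

Lemma rot_cols_mod r A : rot_cols (r %% n.+1) A = rot_cols r A.
Proof.
apply/matrixP => i j; rewrite !mxE; congr (A i _); apply: val_inj.
by rewrite /= !iter_ordS modnDmr.
Qed.

(* The n rotations of A are distinct: if rot_cols r A = rot_cols r' A then the
   rotation making the common value dominating gives two dominating rotations
   of A. *)
Lemma rot_cols_inj A : A \in matricesM k n.+1 ->
  injective (fun r : 'I_n.+1 => rot_cols r A).
Proof.
move=> AM r r' eqA.
have [s] := dominating_rot_exists _ (rot_cols_matricesM r _ AM) => dA.
have := dA; rewrite eqA rot_colsD -rot_cols_mod => dA'.
move: dA; rewrite rot_colsD -rot_cols_mod => dA.
pose o t := Ordinal (ltn_pmod t (ltn0Sn n)).
have [] := dominating_rot_unique A (o (r + s)) (o (r' + s)) AM dA dA'.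
by move/eqP; rewrite eqn_modDr !modn_small // => /eqP /val_inj.
Qed.

Lemma card_cpc_class (B : {set 'M[bool]_(k.+1, n.+1)}) :
  B \in cpc_classes k n.+1 -> #|B| = n.+1.
Proof.
case/imsetP=> A AM ->.
rewrite -[RHS]card_ord -(card_imset predT (rot_cols_inj _ AM)).
apply: eq_card => C.
apply/setIdP/imsetP => [[_ /existsP[r /eqP->]] | [r _ ->]]; first by exists r.
by rewrite rot_cols_matricesM // rot_cols_cpc.
Qed.

Lemma card_matricesM : #|matricesM k n.+1| = 'C(k.+1 * n.+1, n.+2).
Proof.
pose f A : {set 'I_k.+1 * 'I_n.+1} := [set ij | A ij.1 ij.2].
have f_inj : injective f.
  by move=> A B /setP eqf; apply/matrixP => i j; have := eqf (i, j); rewrite !inE.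
rewrite -(card_imset _ f_inj).
have -> : k.+1 * n.+1 = #|{: 'I_k.+1 * 'I_n.+1}| by rewrite card_prod !card_ord.
rewrite -card_draws.
apply: eq_card => S; rewrite [in RHS]inE; apply/imsetP/idP => [[A + ->]|cS].
  by rewrite inE.
exists (\matrix_(i, j) ((i, j) \in S))%R; last first.
  by apply/setP => -[i j]; rewrite inE mxE.
rewrite inE -(eqP cS); apply/eqP/eq_card => -[i j].
by rewrite inE mxE.
Qed.

End Columns.

(** * Up-step counts and heights of words *)

Lemma up_steps_cat s t : up_steps (s ++ t) = up_steps s + up_steps t.
Proof. exact: count_cat. Qed.

Lemma up_steps_nseq_false m : up_steps (nseq m false) = 0.
Proof. by rewrite /up_steps count_nseq. Qed.

Lemma leq_up_steps_take (s : seq bool) (a b : nat) :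
  a <= b -> up_steps (take a s) <= up_steps (take b s).
Proof. by move=> /subnKC <-; rewrite takeD up_steps_cat leq_addr. Qed.

Lemma up_steps_take_sum (s : seq bool) (m : nat) :
  up_steps (take m s) = \sum_(0 <= i < m) nth false s i.
Proof.
elim: s m => [|b s IH] m; first by rewrite big1 // => i _; rewrite nth_nil.
case: m => [|m]; first by rewrite big_geq.
rewrite big_nat_recl //= /up_steps /= -/(up_steps _) IH.
by case: b.
Qed.

Lemma last_trueP (s : seq bool) :
  true \in s -> exists u r, s = u ++ true :: nseq r false.
Proof.
elim/last_ind: s => // s [] IH s_t; first by exists s, 0; rewrite cats1.
move: s_t; rewrite mem_rcons inE => /IH[u [r ->]].
by exists u, (r + 1); rewrite nseqD -cats1 -catA.
Qed.

Lemma heightE (k j : nat) (s : seq bool) :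
  height k j s = ((j + k.+1 * up_steps s)%:Z - (size s)%:Z)%R.
Proof.
rewrite /height /up_steps; elim: s => [|b s IH]; first by rewrite big_nil /=; lia.
rewrite big_cons GRing.addrCA IH /step_rise; case: b => /=; nia.
Qed.

(* With i up-steps, a path from height j can first cross the axis at time
   j + 1 + (k + 1) i, so only these times need checking. *)
Lemma weakly_aboveP (k n j : nat) (s : seq bool) :
  j < k -> size s = k.+1 * n.+1 ->
  reflect (forall i, i <= n -> i < up_steps (take (j.+1 + k.+1 * i) s))
          (weakly_above k j s).
Proof.
move=> jk sz_s; apply: (iffP forallP) => [above i i_le | above [t /= t_lt]].
  have t_lt : j.+1 + k.+1 * i < (size s).+1 by rewrite sz_s; nia.
  have := above (Ordinal t_lt); rewrite heightE /= size_takel //; nia.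
rewrite heightE size_takel //.
have [t_le|t_gt] := leqP t j; first by lia.
have /(above _) : (t - j.+1) %/ k.+1 <= n.
  by rewrite -ltnS ltn_divLR //; nia.
(* Here [i] indexes the last checked time up to [t]: by monotonicity there are at least i + 1
   up-steps by then, while t <= j + (k + 1)(i + 1). *)
have := divn_eq (t - j.+1) k.+1; set i := _ %/ _ => t_eq.
have := @leq_up_steps_take s (j.+1 + k.+1 * i) t.
have := ltn_pmod (t - j.+1) (ltn0Sn k); nia.
Qed.

(** * Words and elevated paths *)

Section Words.

Variables k n : nat.

Definition dominating_words : {set (k.+1 * n.+1).-tuple bool} :=
  [set w : (k.+1 * n.+1).-tuple bool | (up_steps w == n.+2) &&
    [forall m : 'I_n.+1, m.+1 < up_steps (take (k.+1 * m.+1) w)]].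

Definition word_mx (w : (k.+1 * n.+1).-tuple bool) : 'M[bool]_(k.+1, n.+1) :=
  (\matrix_(i, j) nth false w (k.+1 * j + i)%N)%R.

Lemma col_ones_word_mx w m : m <= n.+1 ->
  col_ones k n (word_mx w) m = up_steps (take (k.+1 * m) w).
Proof.
rewrite up_steps_take_sum /col_ones; elim: m => [|m IH] m_lt.
  by rewrite muln0 !big_geq.
rewrite big_nat_recr //= {}IH; last exact: ltnW.
rewrite [in RHS](@big_cat_nat _ _ _ (k.+1 * m)) ?leq_mul //=; congr (_ + _).
rewrite -{1}[k.+1 * m]add0n big_addn mulnS addnK big_mkord.
by apply: eq_bigr => i _; rewrite mxE /= modn_small // addnC.
Qed.

Lemma word_mx_inj : injective word_mx.
Proof.
move=> v w /matrixP eq_vw; apply: val_inj.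
apply: (@eq_from_nth _ false); rewrite !size_tuple // => t t_lt.
have jP : t %/ k.+1 < n.+1 by rewrite ltn_divLR // mulnC.
have := eq_vw (Ordinal (ltn_pmod t (ltn0Sn k))) (Ordinal jP).
by rewrite !mxE /= [k.+1 * (_ %/ _)]mulnC -divn_eq.
Qed.

Lemma word_mx_surj (A : 'M[bool]_(k.+1, n.+1)) : exists w, A = word_mx w.
Proof.
exists [tuple A (inZp t) (inZp (t %/ k.+1)) | t < k.+1 * n.+1].
apply/matrixP => i j; rewrite mxE.
have t_lt : k.+1 * j + i < k.+1 * n.+1.
  have := ltn_ord i; have := ltn_ord j; nia.
rewrite (nth_mktuple _ _ (Ordinal t_lt)) /=.
congr (A _ _); apply: val_inj => /=.
  by rewrite [_ * j]mulnC modnMDl modn_small.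
by rewrite [_ * j]mulnC divnMDl // divn_small // addn0 modn_small.
Qed.

Lemma card_dominating_words :
  #|dominating_words| = #|[set A in matricesM k n.+1 | dominating k n A]|.
Proof.
rewrite -(card_imset _ word_mx_inj); apply: eq_card => A.
have [w ->] := word_mx_surj A.
rewrite (mem_imset _ _ word_mx_inj); apply/setIdP/setIdP.
all: rewrite in_matricesM col_ones_word_mx // take_oversize ?size_tuple //.
all: case=> -> /forallP dw; split=> //; apply/forallP => m; have := dw m.
all: by rewrite col_ones_word_mx.
Qed.

(* Insert an up-step at position j + 1 and pad with down-steps, so that the
   first j + 1 steps grow to a full block of k + 1, and drop the last k - j
   steps, which are down-steps whenever w is an elevated path. *)
Definition insert_up (j : nat) (w : seq bool) : seq bool :=
  take j.+1 w ++ true :: nseq (k - j.+1) false ++ take (k.+1 * n) (drop j.+1 w).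

Lemma size_insert_up (j : nat) (w : seq bool) :
  j < k -> size w = k.+1 * n.+1 -> size (insert_up j w) = k.+1 * n.+1.
Proof.
move=> jk sz_w; rewrite /insert_up size_cat /= size_cat size_nseq.
rewrite !size_takel ?size_drop ?sz_w; nia.
Qed.

(** Block boundaries of the new word match the checked times of the path: both prefixes consist of
    the first j + 1 steps and (k + 1) i further ones, and the new one has one more up-step. *)
Lemma up_steps_take_insert_up (j i : nat) (w : seq bool) :
  j < k -> size w = k.+1 * n.+1 -> i <= n ->
  up_steps (take (k.+1 * i.+1) (insert_up j w)) =
  (up_steps (take (j.+1 + k.+1 * i) w)).+1.
Proof.
move=> jk sz_w i_le; rewrite /insert_up takeD up_steps_cat.
have sz_u : size (take j.+1 w) = j.+1 by rewrite size_takel // sz_w; nia.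
rewrite -cat_rcons catA take_cat size_cat size_rcons size_nseq sz_u ifF; last by nia.
have -> : k.+1 * i.+1 - (j.+2 + (k - j.+1)) = k.+1 * i by nia.
rewrite take_takel; last by rewrite leq_mul.
rewrite !up_steps_cat up_steps_nseq_false -cats1 up_steps_cat /=; lia.
Qed.

Lemma insert_up_tupleP (p : 'I_k * (k.+1 * n.+1).-tuple bool) :
  size (insert_up p.1 p.2) == k.+1 * n.+1.
Proof. by rewrite size_insert_up ?size_tuple. Qed.

Definition insert_up_tuple p : (k.+1 * n.+1).-tuple bool :=
  Tuple (insert_up_tupleP p).

(** The return to the starting height follows from the length and the number of up-steps. *)
Lemma elevated_pathsP (p : 'I_k * (k.+1 * n.+1).-tuple bool) :
  reflect (up_steps p.2 = n.+1 /\
           forall i, i <= n -> i < up_steps (take (p.1.+1 + k.+1 * i) p.2))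
          (p \in elevated_paths k n.+1).
Proof.
case: p => j w; rewrite inE /= /elevated_dyck ltn_ord /= heightE size_tuple.
apply: (iffP andP) => [[/andP[_ above] /eqP up_w] | [up_w above]].
  by split=> //; apply/weakly_aboveP; rewrite ?size_tuple.
rewrite up_w; split=> //; apply/andP; split; first by apply/eqP; lia.
by apply/weakly_aboveP; rewrite ?size_tuple //; exact: above.
Qed.

(** The condition at i = n already accounts for all n + 1 up-steps, so none is left for the last k -
    j steps. *)
Lemma elevated_tail (p : 'I_k * (k.+1 * n.+1).-tuple bool) :
  p \in elevated_paths k n.+1 ->
  p.2 = take (p.1.+1 + k.+1 * n) p.2 ++ nseq (k - p.1) false :> seq bool.
Proof.
case/elevated_pathsP => up_w /(_ n (leqnn n)) tail.
rewrite -{1}[tval p.2](cat_take_drop (p.1.+1 + k.+1 * n)); congr (_ ++ _).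
have -> : k - p.1 = size (drop (p.1.+1 + k.+1 * n) p.2).
  by rewrite size_drop size_tuple; have := ltn_ord p.1; nia.
apply/all_pred1P; rewrite -[all _ _]negbK -has_predC has_count.
have := up_steps_cat (take (p.1.+1 + k.+1 * n) p.2)
                     (drop (p.1.+1 + k.+1 * n) p.2).
rewrite cat_take_drop up_w /up_steps (@eq_count _ (predC _) (pred1 true)); last by case.
move: tail; rewrite /up_steps; lia.
Qed.

Lemma insert_up_dominating (p : 'I_k * (k.+1 * n.+1).-tuple bool) :
  p \in elevated_paths k n.+1 -> insert_up_tuple p \in dominating_words.
Proof.
move=> pE; have [up_w above] := elevated_pathsP _ pE; rewrite inE /=.
apply/andP; split; last first.
  apply/forallP => m; have m_le : m <= n := ltn_ord m.
  by rewrite up_steps_take_insert_up ?size_tuple //; apply: above.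
(* The total is the prefix count at i = n; the dropped tail has no up-step. *)
rewrite -(@take_oversize _ (k.+1 * n.+1) (insert_up _ _));
  last by rewrite size_insert_up ?size_tuple.
rewrite up_steps_take_insert_up ?size_tuple // eqSS; apply/eqP.
have := congr1 up_steps (elevated_tail _ pE).
by rewrite up_w up_steps_cat up_steps_nseq_false addn0.
Qed.

Lemma insert_up_inj :
  {in elevated_paths k n.+1 &, injective insert_up_tuple}.
Proof.
move=> p q pE qE /(congr1 val) /= eq_pq.
have sz_take (r : 'I_k * (k.+1 * n.+1).-tuple bool) :
  size (take r.1.+1 r.2) = r.1.+1.
  by rewrite size_takel // size_tuple; have := ltn_ord r.1; nia.
have eq_j : p.1 = q.1 :> nat.
  wlog lt_pq : p q pE qE eq_pq / p.1 < q.1.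
    by move=> IH; have [/IH->|/IH->|] // := ltngtP p.1 q.1.
  (* At this position [q] has its inserted up-step, whereas [p] is already in its padding of
     down-steps. *)
  have := congr1 (fun s => nth false s q.1.+1) eq_pq.
  rewrite !nth_cat !sz_take ltnn subnn /= ltnS ltnNge (ltnW lt_pq) /=.
  rewrite subSS -[q.1 - p.1]prednK ?subn_gt0 //= nth_cat size_nseq.
  rewrite ifT ?nth_nseq; last first.
    by rewrite -subnS ltn_sub2r ?(leq_ltn_trans lt_pq) ?ltn_ord.
  by case: ifP.
move: p q pE qE eq_pq eq_j => [j v] [j' w] pE qE /= eq_vw /val_inj eq_j.
subst j'; congr (_, _); apply: val_inj => /=.
rewrite (elevated_tail _ pE) (elevated_tail _ qE) /=; congr (_ ++ _).
move/eqP: eq_vw; rewrite eqseq_cat ?(sz_take (j, v)) ?(sz_take (j, w)) //.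
case/andP=> /eqP eq_u; rewrite eqseq_cons eqseq_cat // => /and3P[_ _ /eqP eq_t].
by rewrite [LHS]takeD [RHS]takeD eq_u eq_t.
Qed.

Lemma insert_up_surj w : w \in dominating_words ->
  exists2 p, p \in elevated_paths k n.+1 & w = insert_up_tuple p.
Proof.
rewrite inE => /andP[/eqP up_w /forallP dom].
have sz_b : size (take k.+1 w) = k.+1 by rewrite size_takel // size_tuple; nia.
have := dom ord0; rewrite muln1 /= => up_b.
have [|u [r b_eq]] := last_trueP (take k.+1 w).
  by rewrite -has_pred1 has_count; apply: ltnW.
move: up_b sz_b; rewrite b_eq up_steps_cat /= /up_steps /= count_nseq size_cat /=.
rewrite size_nseq -/(up_steps u) => up_u sz_u.
(* The first block has at least two ones, so [u], which precedes the last of them, is nonempty and j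
   = |u| - 1 makes sense. *)
have u0 : 0 < size u by move: up_u; case: (u).
have jk : (size u).-1 < k by lia.
set v := drop k.+1 w; have w_eq : w = u ++ true :: nseq r false ++ v :> seq bool.
  by rewrite -[LHS](cat_take_drop k.+1) b_eq -catA.
have sz_v : size v = k.+1 * n by rewrite size_drop size_tuple; nia.
pose s := u ++ v ++ nseq (k - (size u).-1) false.
have sz_s : size s == k.+1 * n.+1.
  by rewrite !size_cat size_nseq sz_v; apply/eqP; nia.
have ins_s : insert_up (size u).-1 s = w.
  rewrite /insert_up prednK // take_size_cat // drop_size_cat // take_size_cat //.
  by rewrite w_eq; congr (_ ++ _ :: nseq _ _ ++ _); lia.
exists (Ordinal jk, Tuple sz_s); last exact: val_inj.
apply/elevated_pathsP; split=> /= [|i i_le].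
  rewrite !up_steps_cat up_steps_nseq_false; move: up_w; rewrite w_eq.
  rewrite -cat_rcons -cats1 !up_steps_cat up_steps_nseq_false.
  by rewrite [up_steps [:: true]]/=; lia.
have := dom (Ordinal (i_le : i < n.+1)).
by rewrite -ins_s up_steps_take_insert_up // (eqP sz_s).
Qed.

Lemma card_elevated_paths_dominating :
  #|elevated_paths k n.+1| = #|dominating_words|.
Proof.
rewrite -(card_in_imset insert_up_inj); apply: eq_card => w.
apply/imsetP/idP => [[p pE ->] | /insert_up_surj//].
exact: insert_up_dominating.
Qed.

End Words.

Local Open Scope ring_scope.

Theorem theorem4p1 (k n : nat) (hk : (1 <= k)%N) (hn : (1 <= n)%N) :
  #|cpc_classes k n| = #|elevated_paths k n| /\
  #|elevated_paths k n|%:R = 1 / n%:R * 'C((k + 1) * n, n + 1)%:R :> rat.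
Proof.
case: n hn => // n _.
have eq_classes : #|cpc_classes k n.+1| = #|elevated_paths k n.+1|.
  by rewrite card_cpc_classes_dominating card_elevated_paths_dominating
             card_dominating_words.
split=> //; rewrite -eq_classes !addn1 -card_matricesM.
(* All classes have n elements (here [n.+1]), so the binomial coefficient is n times the number of
   classes. *)
rewrite (card_uniform_partition (card_cpc_class k n) (cpc_partition k n)).
by rewrite natrM mul1r mulrC mulfK // pnatr_eq0.
Qed.
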